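(* Let $\Gamma\cup\{\phi\}$ be a set of $\mathscr{L}$-formulas of inclusion logic $\mathsf{Inc}$. If $\Gamma\vdash_{\mathsf{Inc}}\phi$, then $\Gamma\models\phi$.
   Context: Syntax. $\mathscr{L}$ is a first-order signature with equality. First-order formulas are $\alpha::=\bot\mid t_1=t_2\mid Rt_1\dots t_n\mid\neg\alpha\mid\alpha\wedge\alpha\mid\alpha\vee\alpha\mid\exists x\alpha\mid\forall x\alpha$; $\alpha\to\beta$ abbreviates $\neg\alpha\vee\beta$ and $\alpha\leftrightarrow\beta$ abbreviates $(\alpha\to\beta)\wedge(\beta\to\alpha)$. Formulas of inclusion logic ($\mathsf{Inc}$) are $\phi::=\bot\mid\alpha\mid\neg\alpha\mid x_1\dots x_n\subseteq y_1\dots y_n\mid\phi\wedge\phi\mid\phi\vee\phi\mid\exists x\phi\mid\forall x\phi$ with $\alpha$ first-order (so negation is applied only to first-order formulas). Free variables as usual, with $\mathsf{Fv}(x_1\dots x_n\subseteq y_1\dots y_n)=\{x_1,\dots,x_n,y_1,\dots,y_n\}$. Sans-serif letters $\mathsf{x},\mathsf{y},\dots$ denote finite (possibly empty) sequences of variables, $|\mathsf{x}|$ is the length, $\exists\mathsf{x}$ / $\forall\mathsf{x}$ denote strings of quantifiers, $\mathsf{x}=\mathsf{y}$ abbreviates $\bigwedge_i x_i=y_i$, and $\phi(t/x)$ is substitution ($t$ free for $x$). Semantics. Models have at least two elements. A team $X$ of $M$ is a set of assignments $s:V\to M$ with common domain $V$. $M\models_X\bot$ iff $X=\emptyset$; $M\models_X\alpha$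 (first-order) iff $M\models_s\alpha$ for all $s\in X$; $M\models_X\neg\alpha$ iff $M\not\models_s\alpha$ for all $s\in X$; $M\models_X\mathsf{x}\subseteq\mathsf{y}$ iff for every $s\in X$ there is $s'\in X$ with $s(\mathsf{x})=s'(\mathsf{y})$; $M\models_X\phi\wedge\psi$ iff both hold; $M\models_X\phi\vee\psi$ iff $X=Y\cup Z$ for some $Y,Z\subseteq X$ with $M\models_Y\phi$, $M\models_Z\psi$; $M\models_X\exists x\phi$ iff $M\models_{X(F/x)}\phi$ for some $F:X\to\wp(M)\setminus\{\emptyset\}$, where $X(F/x)=\{s(a/x)\mid s\in X,a\in F(s)\}$; $M\models_X\forall x\phi$ iff $M\models_{X(M/x)}\phi$, where $X(M/x)=\{s(a/x)\mid s\in X,a\in M\}$. $\Gamma\models\phi$ means: for all $M$ and teams $X$ (with domain containing the relevant free variables), if $M\models_X\psi$ for all $\psi\in\Gamma$ then $M\models_X\phi$. Deduction system. $\Gamma\vdash_{\mathsf{Inc}}\phi$ means $\phi$ is derivable from $\Gamma$ in the natural deduction system with the following rules ($\phi,\psi,\chi$ arbitrary $\mathsf{Inc}$-formulas, $\alpha$ first-order; ''fresh'' means not occurring in the formulas involved; ''invertible'' rules may be applied in both directions): (=I) derive $t=t$. (=Sub) from $t=t'$ and $\phi(t/x)$ derive $\phi(t'/x)$. ($\neg$I) from a derivation of $\bot$ from the assumption $\alpha$ derive $\neg\alpha$; ($\neg$E) from $\alpha$ and $\neg\alpha$ derive any $\phi$; (RAA) from a derivation of $\bot$ from the assumption $\neg\alpha$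 derive $\alpha$; in $\neg$I and RAA all other undischarged assumptions of the subderivation must be first-order. ($\wedge$I), ($\wedge$E), ($\vee$I) as usual. ($\vee$E) from $\phi\vee\psi$, a derivation of $\chi$ from $\phi$ and a derivation of $\chi$ from $\psi$, derive $\chi$, provided all other undischarged assumptions of the two subderivations are first-order. ($\exists$I) from $\phi(t/x)$ derive $\exists x\phi$. ($\exists$E) from $\exists x\phi$ and a derivation of $\psi$ from $\phi$ derive $\psi$, provided $x$ is not free in $\psi$ nor in other undischarged assumptions of that subderivation. ($\forall$I) from $\phi$ derive $\forall x\phi$ if $x$ is not free in any undischarged assumption. ($\forall$E) from $\forall x\alpha$ ($\alpha$ first-order) derive $\alpha(t/x)$. ($\forall$E$_0$) from $\forall x\phi$ derive $\phi$ if $x$ is not free in $\phi$. ($\forall$Sub) from $\forall x\phi$ and a derivation of $\psi$ from $\phi(y/x)$ derive $\forall y\psi$, provided $y$ is not free in $\forall x\phi$ nor in other undischarged assumptions of the subderivation. ($\forall$Exc) from $\forall x\forall y\phi$ derive $\forall y\forall x\phi$. ($\forall_\wedge$Ext) from $\forall x\phi$ and $\forall x\psi$ derive $\forall x(\phi\wedge\psi)$. ($\forall_\vee$Ext, invertible) $\forall x\phi(x,\mathsf{v})\vee\psi(\mathsf{v})$ / $\exists y\exists z\forall x((\phi\wedge y=z)\vee(\psi\wedge y\neq z))$, where $x$ is not free in $\psi$ and $y,z$ are fresh. ($\subseteq$Exc) from $\mathsf{x}\mathsf{y}\mathsf{z}\subseteq\mathsf{u}\mathsf{v}\mathsf{w}$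 derive $\mathsf{y}\mathsf{x}\mathsf{z}\subseteq\mathsf{v}\mathsf{u}\mathsf{w}$. ($\subseteq$Ctr) from $\mathsf{x}\mathsf{y}\subseteq\mathsf{u}\mathsf{v}$ derive $\mathsf{x}\subseteq\mathsf{u}$ (with $|\mathsf{x}|=|\mathsf{u}|$). ($\subseteq$Trs) from $\mathsf{x}\subseteq\mathsf{y}$ and $\mathsf{y}\subseteq\mathsf{z}$ derive $\mathsf{x}\subseteq\mathsf{z}$. ($\subseteq$Cmp) from $\mathsf{y}\subseteq\mathsf{x}$ and $\alpha(\mathsf{x}/\mathsf{z})$ derive $\alpha(\mathsf{y}/\mathsf{z})$, where the free variables of $\alpha(\mathsf{x}/\mathsf{z})$ are among $\mathsf{x}$. ($\subseteq$Exp) from a derivation of $\bot$ from the assumptions $\mathsf{y}\subseteq\mathsf{x}$ and $\neg\alpha(\mathsf{y}/\mathsf{z})$ derive $\alpha(\mathsf{x}/\mathsf{z})$, where the free variables of $\alpha(\mathsf{y}/\mathsf{z})$ are among $\mathsf{y}$ and the variables of $\mathsf{y}$ are not free in any other undischarged assumption. ($\subseteq$W$_\exists$) from $\mathsf{x}\subseteq\mathsf{y}$ derive $\exists w(\mathsf{x}w\subseteq\mathsf{y}z)$, $w$ not among $\mathsf{x}\mathsf{y}z$. ($\subseteq$W$_\forall$) from $\mathsf{x}\subseteq\mathsf{y}$ derive $\forall w(\mathsf{x}z\subseteq\mathsf{y}w)$, $w$ not among $\mathsf{x}\mathsf{y}z$. ($\forall\subseteq$Sim, invertible) $\forall\mathsf{x}\phi(\mathsf{x},\mathsf{z})$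 / $\exists\mathsf{x}\forall\mathsf{y}(\mathsf{z}\mathsf{y}\subseteq\mathsf{z}\mathsf{x}\wedge\phi(\mathsf{x},\mathsf{z}))$, with $\mathsf{y}$ fresh, $|\mathsf{y}|=|\mathsf{x}|$. ($\exists\subseteq$Ext) from $\exists\mathsf{x}(\bigwedge_{i\in I}\rho^i\subseteq\sigma^i\wedge\alpha)\vee\phi$ derive $\exists\mathsf{x}\exists u\exists v(\bigwedge_{i\in I}\rho^iuv\subseteq\sigma^iuv\wedge(\alpha\leftrightarrow u=v)\wedge(\alpha\vee\phi))$, where $I$ is finite, each $\rho^i,\sigma^i$ are equal-length sequences of variables from $\mathsf{x}$, and $u,v$ are fresh.
   Formalization: Side conditions added, since the rules as listed are unsound: in ⊆Exp, y distinct and disjoint from x; in ⊆Cmp, ⊆Exp, z distinct, Fv(α) among z; in ∃⊆Ext, x not free in φ; in ∀⊆Sim, x and y each distinct, x, y, z pairwise disjoint, Fv(φ) among x,z. *)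

(* Defs.v *)
From mathcomp Require Import all_boot.
From mathcomp Require Import boolp classical_sets.

Set Implicit Arguments.
Unset Strict Implicit.
Unset Printing Implicit Defensive.

Local Open Scope classical_set_scope.

Definition var := nat.

Definition upd {T : Type} (f : var -> T) (x : var) (a : T) : var -> T :=
  fun v => if v == x then a else f v.

Record signature := Signature {
  funsym : Type;
  fun_arity : funsym -> nat;
  relsym : Type;
  rel_arity : relsym -> nat
}.

Inductive term (L : signature) : Type :=
| Var (x : var)
| App (f : funsym L) (ts : 'I_(fun_arity f) -> term L).

Arguments Var {L} x.

Inductive fo (L : signature) : Type :=
| FBot
| FEq (t u : term L)
| FRel (R : relsym L) (ts : 'I_(rel_arity R) -> term L)
| FNeg (a : fo L)
| FAnd (a b : fo L)
| FOr (a b : fo L)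
| FEx (x : var) (a : fo L)
| FAll (x : var) (a : fo L).

Arguments FBot {L}.

Definition FImp L (a b : fo L) := FOr (FNeg a) b.
Definition FIff L (a b : fo L) := FAnd (FImp a b) (FImp b a).

(* Only the atoms and the negations of first-order formulas are primitive here:
   a compound first-order formula is the image under [inc_of_fo], so that, as
   for strings of symbols, the conjunction of two first-order formulas is the
   same formula whether it is read in first-order logic or in inclusion
   logic. *)
Inductive inc (L : signature) : Type :=
| Bot
| Eq (t u : term L)
| Rel (R : relsym L) (ts : 'I_(rel_arity R) -> term L)
| Neg (a : fo L)
| Incl (n : nat) (x y : n.-tuple var)
| And (p q : inc L)
| Or (p q : inc L)
| Ex (x : var) (p : inc L)
| All (x : var) (p : inc L).

Arguments Bot {L}.
Arguments Incl {L n} x y.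

Fixpoint inc_of_fo L (a : fo L) : inc L :=
  match a with
  | FBot => Bot
  | FEq t u => Eq t u
  | FRel R ts => Rel ts
  | FNeg a => Neg a
  | FAnd a b => And (inc_of_fo a) (inc_of_fo b)
  | FOr a b => Or (inc_of_fo a) (inc_of_fo b)
  | FEx x a => Ex x (inc_of_fo a)
  | FAll x a => All x (inc_of_fo a)
  end.

Coercion inc_of_fo : fo >-> inc.

Definition Exs L (xs : seq var) (p : inc L) : inc L := foldr (@Ex L) p xs.
Definition Alls L (xs : seq var) (p : inc L) : inc L := foldr (@All L) p xs.

(* The conjunction of the members of [ps] and of [p]; it is [p] itself when
   [ps] is empty. *)
Definition Ands L (ps : seq (inc L)) (p : inc L) : inc L := foldr (@And L) p ps.

Fixpoint term_fv L (t : term L) : set var :=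
  match t with
  | Var x => [set x]
  | App f ts => [set v | exists i, term_fv (ts i) v]
  end.

Fixpoint fo_fv L (a : fo L) : set var :=
  match a with
  | FBot => set0
  | FEq t u => term_fv t `|` term_fv u
  | FRel R ts => [set v | exists i, term_fv (ts i) v]
  | FNeg a => fo_fv a
  | FAnd a b | FOr a b => fo_fv a `|` fo_fv b
  | FEx x a | FAll x a => fo_fv a `\` [set x]
  end.

Fixpoint fv L (p : inc L) : set var :=
  match p with
  | Bot => set0
  | Eq t u => term_fv t `|` term_fv u
  | Rel R ts => [set v | exists i, term_fv (ts i) v]
  | Neg a => fo_fv a
  | Incl n x y => [set v : var | (v \in x) || (v \in y)]
  | And p q | Or p q => fv p `|` fv q
  | Ex x p | All x p => fv p `\` [set x]
  end.

Fixpoint fo_occ L (a : fo L) : set var :=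
  match a with
  | FBot => set0
  | FEq t u => term_fv t `|` term_fv u
  | FRel R ts => [set v | exists i, term_fv (ts i) v]
  | FNeg a => fo_occ a
  | FAnd a b | FOr a b => fo_occ a `|` fo_occ b
  | FEx x a | FAll x a => fo_occ a `|` [set x]
  end.

(* Fresh means outside [occ], which also contains the bound variables. *)
Fixpoint occ L (p : inc L) : set var :=
  match p with
  | Bot => set0
  | Eq t u => term_fv t `|` term_fv u
  | Rel R ts => [set v | exists i, term_fv (ts i) v]
  | Neg a => fo_occ a
  | Incl n x y => [set v : var | (v \in x) || (v \in y)]
  | And p q | Or p q => occ p `|` occ q
  | Ex x p | All x p => occ p `|` [set x]
  end.

Fixpoint term_sub L (sg : var -> term L) (t : term L) : term L :=
  match t with
  | Var x => sg x
  | App f ts => App (fun i => term_sub sg (ts i))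
  end.

(* Substitution does not rename bound variables; [free_for] below is the
   condition under which it is meaningful. *)
Fixpoint fo_sub L (sg : var -> term L) (a : fo L) : fo L :=
  match a with
  | FBot => FBot
  | FEq t u => FEq (term_sub sg t) (term_sub sg u)
  | FRel R ts => FRel (fun i => term_sub sg (ts i))
  | FNeg a => FNeg (fo_sub sg a)
  | FAnd a b => FAnd (fo_sub sg a) (fo_sub sg b)
  | FOr a b => FOr (fo_sub sg a) (fo_sub sg b)
  | FEx x a => FEx x (fo_sub (upd sg x (Var x)) a)
  | FAll x a => FAll x (fo_sub (upd sg x (Var x)) a)
  end.

(* Inclusion atoms only contain variables. The default branch is never reached
   when [free_for] holds. *)
Definition var_sub L (sg : var -> term L) (x : var) : var :=
  if sg x is Var y then y else x.

Fixpoint sub L (sg : var -> term L) (p : inc L) : inc L :=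
  match p with
  | Bot => Bot
  | Eq t u => Eq (term_sub sg t) (term_sub sg u)
  | Rel R ts => Rel (fun i => term_sub sg (ts i))
  | Neg a => Neg (fo_sub sg a)
  | Incl n x y => Incl (map_tuple (var_sub sg) x) (map_tuple (var_sub sg) y)
  | And p q => And (sub sg p) (sub sg q)
  | Or p q => Or (sub sg p) (sub sg q)
  | Ex x p => Ex x (sub (upd sg x (Var x)) p)
  | All x p => All x (sub (upd sg x (Var x)) p)
  end.

Fixpoint fo_free_for L (sg : var -> term L) (a : fo L) : Prop :=
  match a with
  | FBot | FEq _ _ | FRel _ _ => True
  | FNeg a => fo_free_for sg a
  | FAnd a b | FOr a b => fo_free_for sg a /\ fo_free_for sg b
  | FEx x a | FAll x a =>
      (forall v, (fo_fv a `\` [set x]) v -> ~ term_fv (sg v) x) /\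
      fo_free_for (upd sg x (Var x)) a
  end.

(* The terms [sg v] are free for the variables [v] in [p], and a variable that
   is free in an inclusion atom is replaced by a variable. *)
Fixpoint free_for L (sg : var -> term L) (p : inc L) : Prop :=
  match p with
  | Bot | Eq _ _ | Rel _ _ => True
  | Neg a => fo_free_for sg a
  | Incl n x y =>
      forall v, (v \in x) || (v \in y) -> exists w, sg v = Var w
  | And p q | Or p q => free_for sg p /\ free_for sg q
  | Ex x p | All x p =>
      (forall v, (fv p `\` [set x]) v -> ~ term_fv (sg v) x) /\
      free_for (upd sg x (Var x)) p
  end.

Definition sub1 L (x : var) (t : term L) : var -> term L := upd Var x t.

(* The simultaneous substitution of [x] for [z], used when [z] has no
   repetition; variables outside [z] are left unchanged. *)
Definition subs L n (z x : n.-tuple var) : var -> term L :=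
  fun v => Var (nth v x (index v z)).

Arguments subs {L n} z x.

Record model (L : signature) := Model {
  carrier :> Type;
  fun_int : forall f : funsym L, ('I_(fun_arity f) -> carrier) -> carrier;
  rel_int : forall R : relsym L, ('I_(rel_arity R) -> carrier) -> Prop;
  two_elements : exists a b : carrier, a <> b
}.

(* [s v = None] when [v] is outside the domain of [s]. *)
Definition assignment L (M : model L) := var -> option M.

Definition team_on L (M : model L) (V : set var) (X : set (assignment M)) :=
  forall s, X s -> forall v, V v <-> s v <> None.

(* [term_val s t a]: the value of [t] under [s] is defined and equal to [a]. *)
Fixpoint term_val L (M : model L) (s : assignment M) (t : term L) (a : M)
    : Prop :=
  match t with
  | Var x => s x = Some a
  | App f ts => exists2 b : 'I_(fun_arity f) -> M,
      forall i, term_val s (ts i) (b i) & fun_int b = a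
  end.

Fixpoint fo_sat L (M : model L) (s : assignment M) (a : fo L) : Prop :=
  match a with
  | FBot => False
  | FEq t u => exists2 c, term_val s t c & term_val s u c
  | FRel R ts => exists2 b : 'I_(rel_arity R) -> M,
      forall i, term_val s (ts i) (b i) & rel_int b
  | FNeg a => ~ fo_sat s a
  | FAnd a b => fo_sat s a /\ fo_sat s b
  | FOr a b => fo_sat s a \/ fo_sat s b
  | FEx x a => exists c : M, fo_sat (upd s x (Some c)) a
  | FAll x a => forall c : M, fo_sat (upd s x (Some c)) a
  end.

Definition supplement L (M : model L) (X : set (assignment M))
    (F : assignment M -> set M) (x : var) : set (assignment M) :=
  [set s' | exists s c, [/\ X s, F s c & s' = upd s x (Some c)]].

Definition duplicate L (M : model L) (X : set (assignment M)) (x : var)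
    : set (assignment M) :=
  supplement X (fun=> setT) x.

(* The clause for arbitrary first-order formulas is [team_sat_fo] below. *)
Fixpoint team_sat L (M : model L) (X : set (assignment M)) (p : inc L) : Prop :=
  match p with
  | Bot => X = set0
  | Eq t u => forall s, X s -> fo_sat s (FEq t u)
  | Rel R ts => forall s, X s -> fo_sat s (FRel ts)
  | Neg a => forall s, X s -> ~ fo_sat s a
  | Incl n x y => forall s, X s -> exists2 s', X s' & map s x = map s' y
  | And p q => team_sat X p /\ team_sat X q
  | Or p q => exists Y Z, [/\ X = Y `|` Z, team_sat Y p & team_sat Z q]
  | Ex x p => exists2 F : assignment M -> set M,
      forall s, X s -> F s !=set0 & team_sat (supplement X F x) p
  | All x p => team_sat (duplicate X x) p
  end.

Lemma team_sat_fo L (M : model L) (a : fo L) (X : set (assignment M)) :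
  team_sat X a <-> forall s, X s -> fo_sat s a.
Proof.
elim: a X => [|t u|R ts|a _|a IHa b IHb|a IHa b IHb|x a IHa|x a IHa] X //=.
- by split=> [->|h] //; rewrite -subset0 => s /h.
- by rewrite IHa IHb; split=> [[ha hb] s Xs|h]; split; firstorder.
- split=> [[Y [Z [-> /IHa hY /IHb hZ]]] s [/hY|/hZ]|h]; [by left|by right|].
  exists [set s | X s /\ fo_sat s a], [set s | X s /\ fo_sat s b].
  split; [|by apply/IHa => s []|by apply/IHb => s []].
  by apply/seteqP; split=> s => [Xs|[[]|[]]] //; case: (h s Xs); [left|right].
- split=> [[F F0 /IHa h] s Xs|h].
    by have [c Fc] := F0 _ Xs; exists c; apply: h; exists s, c.
  exists (fun s => [set c | fo_sat (upd s x (Some c)) a]) => [s /h //|].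
  by apply/IHa => _ [s [c [_ hc ->]]].
- rewrite IHa; split=> [h s Xs c|h _ [s [c [Xs _ ->]]]]; last exact: h.
  by apply: h; exists s, c.
Qed.

Definition entails L (G : set (inc L)) (p : inc L) : Prop :=
  forall (M : model L) (V : set var) (X : set (assignment M)),
    team_on V X ->
    (forall q, G q -> fv q `<=` V) -> fv p `<=` V ->
    (forall q, G q -> team_sat X q) -> team_sat X p.

Definition first_order L (B : set (inc L)) : Prop :=
  forall q, B q -> exists a : fo L, q = a.

Definition not_free_in L (x : var) (B : set (inc L)) : Prop :=
  forall q, B q -> ~ fv q x.

Definition disj (x y : seq var) : Prop := forall v, v \in x -> v \notin y.

Definition or_ext L (x y z : var) (p q : inc L) : inc L :=
  Ex y (Ex z (All x (Or (And p (Eq (Var y) (Var z)))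
                        (And q (Neg (FEq (Var y) (Var z))))))).

Definition or_ext_side L (x y z : var) (p q : inc L) : Prop :=
  [/\ ~ fv q x, y <> z,
      ~ occ (Or (All x p) q) y & ~ occ (Or (All x p) q) z].

Definition sim L n m (x y : n.-tuple var) (z : m.-tuple var) (p : inc L)
    : inc L :=
  Exs x (Alls y (And (Incl (cat_tuple z y) (cat_tuple z x)) p)).

(* [z] lists all the parameters of [p]: reading off the whole domain from
   [zy] included in [zx] is only correct when the free variables of [p] are
   among [x] and [z], without clashes between [x], [y] and [z]. *)
Definition sim_side L n m (x y : n.-tuple var) (z : m.-tuple var) (p : inc L)
    : Prop :=
  [/\ uniq x, uniq y, disj x z & forall v, fv p v -> v \in x ++ z] /\
  (forall v, v \in y -> ~ occ p v /\ v \notin x ++ z).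

(* [deriv A p]: there is a derivation of [p] all of whose undischarged
   assumptions belong to [A]. When a rule restricts the undischarged
   assumptions of a subderivation, these are collected in a subset [B] of [A],
   to which the discharged assumptions are added. *)
Inductive deriv (L : signature) : set (inc L) -> inc L -> Prop :=
| Assume A p : A p -> deriv A p
| EqI A t : deriv A (Eq t t)
| EqSub A t t' x p :
    free_for (sub1 x t) p -> free_for (sub1 x t') p ->
    deriv A (Eq t t') -> deriv A (sub (sub1 x t) p) ->
    deriv A (sub (sub1 x t') p)
| NegI A B (a : fo L) :
    B `<=` A -> first_order B ->
    deriv (B `|` [set (a : inc L)]) Bot -> deriv A (Neg a)
| NegE A (a : fo L) p : deriv A a -> deriv A (Neg a) -> deriv A p
| RAA A B (a : fo L) :
    B `<=` A -> first_order B ->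
    deriv (B `|` [set Neg a]) Bot -> deriv A a
| AndI A p q : deriv A p -> deriv A q -> deriv A (And p q)
| AndE1 A p q : deriv A (And p q) -> deriv A p
| AndE2 A p q : deriv A (And p q) -> deriv A q
| OrI1 A p q : deriv A p -> deriv A (Or p q)
| OrI2 A p q : deriv A q -> deriv A (Or p q)
| OrE A B p q r :
    B `<=` A -> first_order B ->
    deriv A (Or p q) -> deriv (B `|` [set p]) r -> deriv (B `|` [set q]) r ->
    deriv A r
| ExI A x t p :
    free_for (sub1 x t) p -> deriv A (sub (sub1 x t) p) -> deriv A (Ex x p)
| ExE A B x p q :
    B `<=` A -> not_free_in x B -> ~ fv q x ->
    deriv A (Ex x p) -> deriv (B `|` [set p]) q -> deriv A q
| AllI A B x p :
    B `<=` A -> not_free_in x B -> deriv B p -> deriv A (All x p)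
| AllE A x t (a : fo L) :
    fo_free_for (sub1 x t) a ->
    deriv A (All x a) -> deriv A (fo_sub (sub1 x t) a)
| AllE0 A x p : ~ fv p x -> deriv A (All x p) -> deriv A p
| AllSub A B x y p q :
    B `<=` A -> not_free_in y B -> ~ fv (All x p) y ->
    free_for (sub1 x (Var y)) p ->
    deriv A (All x p) -> deriv (B `|` [set sub (sub1 x (Var y)) p]) q ->
    deriv A (All y q)
| AllExc A x y p : deriv A (All x (All y p)) -> deriv A (All y (All x p))
| AllAndExt A x p q :
    deriv A (All x p) -> deriv A (All x q) -> deriv A (All x (And p q))
| AllOrExt A x y z p q :
    or_ext_side x y z p q ->
    deriv A (Or (All x p) q) -> deriv A (or_ext x y z p q)
| AllOrExtInv A x y z p q :
    or_ext_side x y z p q ->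
    deriv A (or_ext x y z p q) -> deriv A (Or (All x p) q)
| InclExc A k l m (x u : k.-tuple var) (y v : l.-tuple var)
    (z w : m.-tuple var) :
    deriv A (Incl (cat_tuple x (cat_tuple y z))
                  (cat_tuple u (cat_tuple v w))) ->
    deriv A (Incl (cat_tuple y (cat_tuple x z))
                  (cat_tuple v (cat_tuple u w)))
| InclCtr A k l (x u : k.-tuple var) (y v : l.-tuple var) :
    deriv A (Incl (cat_tuple x y) (cat_tuple u v)) -> deriv A (Incl x u)
| InclTrs A n (x y z : n.-tuple var) :
    deriv A (Incl x y) -> deriv A (Incl y z) -> deriv A (Incl x z)
(* The substitution instances of [a] have no free variables but those put in
   place of [z], hence [fo_fv a] is among [z]. *)
| InclCmp A n (x y z : n.-tuple var) (a : fo L) :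
    uniq z -> (forall v, fo_fv a v -> v \in z) ->
    fo_free_for (subs z x) a -> fo_free_for (subs z y) a ->
    deriv A (Incl y x) -> deriv A (fo_sub (subs z x) a) ->
    deriv A (fo_sub (subs z y) a)
(* The variables [y] are the eigenvariables of the rule: without repetition,
   and not among [x], which is free in the conclusion. *)
| InclExp A B n (x y z : n.-tuple var) (a : fo L) :
    uniq z -> (forall v, fo_fv a v -> v \in z) ->
    fo_free_for (subs z x) a -> fo_free_for (subs z y) a ->
    uniq y -> disj y x ->
    B `<=` A -> (forall v, v \in y -> not_free_in v B) ->
    deriv (B `|` [set Incl y x; Neg (fo_sub (subs z y) a)]) Bot ->
    deriv A (fo_sub (subs z x) a)
| InclWEx A n (x y : n.-tuple var) (z w : var) :
    w \notin x -> w \notin y -> w <> z ->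
    deriv A (Incl x y) ->
    deriv A (Ex w (Incl (cat_tuple x [tuple w]) (cat_tuple y [tuple z])))
| InclWAll A n (x y : n.-tuple var) (z w : var) :
    w \notin x -> w \notin y -> w <> z ->
    deriv A (Incl x y) ->
    deriv A (All w (Incl (cat_tuple x [tuple z]) (cat_tuple y [tuple w])))
| AllInclSim A n m (x y : n.-tuple var) (z : m.-tuple var) p :
    sim_side x y z p -> deriv A (Alls x p) -> deriv A (sim x y z p)
| AllInclSimInv A n m (x y : n.-tuple var) (z : m.-tuple var) p :
    sim_side x y z p -> deriv A (sim x y z p) -> deriv A (Alls x p)
(* [p] moves into the scope of the quantifiers on [x], so [x] must not be free
   in it. *)
| ExInclExt A (x : seq var) (u v : var) k (n : 'I_k -> nat)
    (rho sigma : forall i : 'I_k, (n i).-tuple var) (a : fo L) p :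
    (forall i w, (w \in rho i) || (w \in sigma i) -> w \in x) ->
    (forall w, w \in x -> ~ fv p w) ->
    u <> v ->
    (forall w, w = u \/ w = v ->
       [/\ w \notin x, ~ fo_occ a w & ~ occ p w]) ->
    deriv A
      (Or (Exs x (Ands [seq Incl (rho i) (sigma i) | i <- enum 'I_k] a)) p) ->
    deriv A
      (Exs x (Ex u (Ex v
        (Ands [seq Incl (cat_tuple (rho i) [tuple u; v])
                        (cat_tuple (sigma i) [tuple u; v]) | i <- enum 'I_k]
              (And (FIff a (FEq (Var u) (Var v))) (Or a p)))))).

(* Main.v *)
(** Induction on the derivation, over teams of total assignments. Two teams are
    compared through the back-and-forth (Egli-Milner) lifting of a relation
    between assignments: an existential quantifier passes to a team related by
    the lifting of "differs at most at x", and locality and the substitution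
    lemma say that satisfaction is invariant under the lifting of agreement on
    the free variables, respectively of "s' is s composed with the
    substitution". The rules with first-order side assumptions rest on
    flatness, and disjunction elimination also on closure under unions. *)
Require Import Defs.
From mathcomp Require Import all_boot.
From mathcomp Require Import boolp classical_sets.

Set Implicit Arguments.
Unset Strict Implicit.
Unset Printing Implicit Defensive.

Local Open Scope classical_set_scope.

(** * Egli-Milner lifting of relations to sets *)

Definition lift A B (R : A -> B -> Prop) (X : set A) (Y : set B) :=
  (forall a, X a -> exists2 b, Y b & R a b) /\
  (forall b, Y b -> exists2 a, X a & R a b).

Definition rel_image A B (R : A -> B -> Prop) (X : set A) : set B :=
  [set b | exists2 a, X a & R a b].

Lemma lift_sym A B (R : A -> B -> Prop) X Y :
  lift R X Y -> lift (fun b a => R a b) Y X.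
Proof. by case. Qed.

Lemma lift_rel_image A B (R : A -> B -> Prop) X :
  (forall a, X a -> exists b, R a b) -> lift R X (rel_image R X).
Proof.
move=> h; split=> // a Xa; have [b Rab] := h a Xa.
by exists b => //; exists a.
Qed.

Lemma lift_comp A B C (R : A -> B -> Prop) (S : B -> C -> Prop)
    (T : A -> C -> Prop) X Y Z :
  (forall a b c, R a b -> S b c -> T a c) ->
  lift R X Y -> lift S Y Z -> lift T X Z.
Proof.
move=> RST [RXY RYX] [SYZ SZY]; split=> [a /RXY|c /SZY].
  by move=> [b /SYZ[c Zc Sbc] Rab]; exists c => //; exact: RST Sbc.
by move=> [b /RYX[a Xa Rab] Sbc]; exists a => //; exact: RST Sbc.
Qed.

(** Carries the team chosen for an existential quantifier along a lifted relation. The set [Y']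
    collects every [b'] completing a square over some related [a], [b] and [a'], which is enough to
    reach all of [Y] and all of [X']. *)
Lemma lift_square A B A' B' (R : A -> B -> Prop) (R' : A' -> B' -> Prop)
    (S : A -> A' -> Prop) (T : B -> B' -> Prop) X Y X' :
  (forall a b a', R a b -> S a a' -> exists2 b', T b b' & R' a' b') ->
  lift R X Y -> lift S X X' ->
  exists2 Y', lift T Y Y' & lift R' X' Y'.
Proof.
move=> sq [RXY RYX] [SXX' SX'X].
exists [set b' | exists a b a',
  [/\ Y b, X' a', R a b & S a a'] /\ (T b b' /\ R' a' b')].
  split=> [b Yb|b' [a [b [a' [[Yb _ _ _] [Tb _]]]]]]; last by exists b.
  have [a Xa Rab] := RYX b Yb; have [a' Xa' Sa] := SXX' a Xa.
  by have [b' Tb Rb] := sq _ _ _ Rab Sa; exists b' => //; exists a, b, a'.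
split=> [a' Xa'|b' [a [b [a' [[_ Xa' _ _] [_ Rb]]]]]]; last by exists a'.
have [a Xa Sa] := SX'X a' Xa'; have [b Yb Rab] := RXY a Xa.
by have [b' Tb Rb] := sq _ _ _ Rab Sa; exists b' => //; exists a, b, a'.
Qed.

(** The counterpart for universal quantifiers: the two new sets are determined by [X] and [Y], so
    squares must be completed from either side. *)
Lemma lift_square_image A B A' B' (R : A -> B -> Prop) (R' : A' -> B' -> Prop)
    (S : A -> A' -> Prop) (T : B -> B' -> Prop) X Y :
  (forall a b a', R a b -> S a a' -> exists2 b', T b b' & R' a' b') ->
  (forall a b b', R a b -> T b b' -> exists2 a', S a a' & R' a' b') ->
  lift R X Y -> lift R' (rel_image S X) (rel_image T Y).
Proof.
move=> sq1 sq2 [RXY RYX]; split=> [a' [a Xa Sa]|b' [b Yb Tb]].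
  have [b Yb Rab] := RXY a Xa; have [b' Tb Rb] := sq1 _ _ _ Rab Sa.
  by exists b' => //; exists b.
have [a Xa Rab] := RYX b Yb; have [a' Sa Ra] := sq2 _ _ _ Rab Tb.
by exists a' => //; exists a.
Qed.

(** Carries over the splitting of a team in a disjunction. An element of [W] enters each part in
    which it has a partner, hence possibly both, since parts may overlap. *)
Lemma lift_setU A B (R : A -> B -> Prop) Y Z W :
  lift R (Y `|` Z) W ->
  exists Y' Z', [/\ W = Y' `|` Z', lift R Y Y' & lift R Z Z'].
Proof.
move=> [RXW RWX].
exists [set b | W b /\ exists2 a, Y a & R a b],
  [set b | W b /\ exists2 a, Z a & R a b]; split.
- apply/seteqP; split=> b => [Wb|[[]|[]]] //.
  by have [a [Ya|Za] Rab] := RWX b Wb; [left|right]; split=> //; exists a.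
- split=> [a Ya|b [_]] //; have [b Wb Rab] := RXW a (or_introl Ya).
  by exists b => //; split=> //; exists a.
- split=> [a Za|b [_]] //; have [b Wb Rab] := RXW a (or_intror Za).
  by exists b => //; split=> //; exists a.
Qed.

Lemma lift_set0 A B (R : A -> B -> Prop) X Y :
  lift R X Y -> X = set0 <-> Y = set0.
Proof.
move=> [h1 h2]; split=> e; rewrite -subset0 => a.
  by move=> /h2[b]; rewrite e.
by move=> /h1[b]; rewrite e.
Qed.

(** * Updates, and satisfaction over total assignments *)

Lemma updE T (f : var -> T) x a : upd f x a x = a.
Proof. by rewrite /upd eqxx. Qed.

Lemma updN T (f : var -> T) x a v : v <> x -> upd f x a v = f v.
Proof. by move=> /eqP/negbTE e; rewrite /upd e. Qed.

Definition varies T (x : var) (s t : var -> T) := exists c, t = upd s x c.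

Lemma varies_refl T x (s : var -> T) : varies x s s.
Proof. by exists (s x); apply/funext => v; rewrite /upd; case: eqP => [->|]. Qed.

(* Derivations go through formulas whose free variables need not lie in the
   domain of the given team, so the rules are checked on total assignments. *)
Fixpoint teval L (M : model L) (s : var -> M) (t : term L) : M :=
  match t with
  | Var x => s x
  | App f ts => fun_int (fun i => teval s (ts i))
  end.

Fixpoint tfo L (M : model L) (s : var -> M) (a : fo L) : Prop :=
  match a with
  | FBot => False
  | FEq t u => teval s t = teval s u
  | FRel R ts => rel_int (fun i => teval s (ts i))
  | FNeg a => ~ tfo s a
  | FAnd a b => tfo s a /\ tfo s b
  | FOr a b => tfo s a \/ tfo s b
  | FEx x a => exists c : M, tfo (upd s x c) a
  | FAll x a => forall c : M, tfo (upd s x c) a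
  end.

Fixpoint tsat L (M : model L) (X : set (var -> M)) (p : inc L) : Prop :=
  match p with
  | Bot => X = set0
  | Eq t u => forall s, X s -> tfo s (FEq t u)
  | Rel R ts => forall s, X s -> tfo s (FRel ts)
  | Neg a => forall s, X s -> ~ tfo s a
  | Incl n x y => forall s, X s -> exists2 s', X s' & map s x = map s' y
  | And p q => tsat X p /\ tsat X q
  | Or p q => exists Y Z, [/\ X = Y `|` Z, tsat Y p & tsat Z q]
  | Ex x p => exists2 X', lift (varies x) X X' & tsat X' p
  | All x p => tsat (rel_image (varies x) X) p
  end.

(** * Comparison of partial and total assignments *)

Definition represents L (M : model L) (V : set var) (s : assignment M)
    (t : var -> M) := forall v, V v -> s v = Some (t v).

Lemma term_val_teval L (M : model L) (u : term L) (s : assignment M) t a :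
  represents (term_fv u) s t -> term_val s u a <-> teval t u = a.
Proof.
elim: u a => [x|f ts IH] a /= st.
  by rewrite st//; split=> [[]|->].
have {}IH i b : term_val s (ts i) b <-> teval t (ts i) = b.
  by apply: IH => v vi; apply: st; exists i.
split=> [[b hb <-]|<-].
  by congr fun_int; apply/funext => i; apply/IH.
by exists (fun i => teval t (ts i)) => // i; apply/IH.
Qed.

Lemma represents_upd L (M : model L) V x (s : assignment M) t c :
  represents (V `\` [set x]) s t -> represents V (upd s x (Some c)) (upd t x c).
Proof.
move=> st v Vv; have [->|vx] := pselect (v = x); first by rewrite !updE.
by rewrite !updN//; apply: st.
Qed.

Lemma fo_sat_tfo L (M : model L) (a : fo L) (s : assignment M) t :
  represents (fo_fv a) s t -> fo_sat s a <-> tfo t a.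
Proof.
elim: a s t => [|u w|R ts|a IH|a IHa b IHb|a IHa b IHb|x a IH|x a IH] s t //= st.
- have hu : represents (term_fv u) s t by move=> v h; apply: st; left.
  have hw : represents (term_fv w) s t by move=> v h; apply: st; right.
  split=> [[c /(term_val_teval _ hu) -> /(term_val_teval _ hw) ->] //|e].
  by exists (teval t u); [apply/(term_val_teval _ hu)|apply/(term_val_teval _ hw)].
- have hi i : represents (term_fv (ts i)) s t by move=> v h; apply: st; exists i.
  split=> [[b hb rb]|h].
    suff <- : b = (fun i => teval t (ts i)) by [].
    by apply/funext => i; apply/esym/(term_val_teval _ (hi i)).
  by exists (fun i => teval t (ts i)) => // i; apply/(term_val_teval _ (hi i)).
- by rewrite (IH s t).
- by rewrite (IHa s t) 1?(IHb s t)// => v h; apply: st; [right|left].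
- by rewrite (IHa s t) 1?(IHb s t)// => v h; apply: st; [right|left].
- have ux c := represents_upd c st.
  by split=> -[c hc]; exists c; [apply: (iffLR (IH _ _ (ux c)))|
    apply: (iffRL (IH _ _ (ux c)))].
- have ux c := represents_upd c st.
  by split=> h c; [apply: (iffLR (IH _ _ (ux c)))|
    apply: (iffRL (IH _ _ (ux c)))].
Qed.

Lemma eq_map_cat T (s s' : var -> T) (x y u v : seq var) :
  size x = size u ->
  map s (x ++ y) = map s' (u ++ v) <-> map s x = map s' u /\ map s y = map s' v.
Proof.
move=> e; rewrite !map_cat; split=> [|[-> ->]] //.
elim: x u e => [|a x IH] [|b u] //= [/IH{}IH].
by case=> -> /IH[-> ->].
Qed.

Lemma map_represents L (M : model L) (x : seq var) (s : assignment M) t :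
  represents [set v | v \in x] s t -> map s x = map Some (map t x).
Proof. by move=> st; rewrite -map_comp; apply/eq_in_map => v /st. Qed.

Lemma lift_represents_sub L (M : model L) V W (X : set (assignment M)) Y :
  V `<=` W -> lift (@represents L M W) X Y -> lift (@represents L M V) X Y.
Proof.
move=> VW [h1 h2]; split=> [s /h1[t Yt st]|t /h2[s Xs st]].
  by exists t => // v /VW /st.
by exists s => // v /VW /st.
Qed.

(** On partial assignments [varies] would also admit the new value [None], that is, removing [x]
    from the domain. *)
Definition pvaries L (M : model L) x (s t : assignment M) :=
  exists c, t = upd s x (Some c).

(** From a related team [X'], let [F s] be the set of all [c] for which updating [s] at [x] by [c]
    leads into [X']. One half of the lifting makes [F s] nonempty, the other shows that the
    supplement by [F] exhausts [X']. *)
Lemma team_sat_Ex L (M : model L) (X : set (assignment M)) x p :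
  team_sat X (Ex x p) <-> exists2 X', lift (@pvaries L M x) X X' & team_sat X' p.
Proof.
split=> [[F F0 h]|[X' [h1 h2] h]].
  exists (supplement X F x) => //; split=> [s Xs|_ [s [c [Xs Fc ->]]]].
    by have [c Fc] := F0 s Xs; exists (upd s x (Some c)); [exists s, c|exists c].
  by exists s => //; exists c.
exists (fun s => [set c | X' (upd s x (Some c))]) => [s /h1[t Xt [c e]]|].
  by exists c; rewrite /= -e.
suff -> : supplement X (fun s => [set c | X' (upd s x (Some c))]) x = X' by [].
apply/seteqP; split=> [_ [s [c [_ ? ->]]]|t Xt] //.
by have [s Xs [c e]] := h2 t Xt; exists s, c; split=> //=; rewrite -e.
Qed.

Lemma duplicateE L (M : model L) (X : set (assignment M)) x :
  duplicate X x = rel_image (@pvaries L M x) X.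
Proof.
apply/seteqP; split=> [_ [s [c [? _ ->]]]|_ [s ? [c ->]]].
  by exists s => //; exists c.
by exists s, c.
Qed.

Lemma team_sat_tsat L (M : model L) (p : inc L) (X : set (assignment M)) Y :
  lift (@represents L M (fv p)) X Y -> team_sat X p <-> tsat Y p.
Proof.
have flat (a : fo L) (X0 : set (assignment M)) Y0 :
    lift (@represents L M (fo_fv a)) X0 Y0 ->
    ((forall s, X0 s -> fo_sat s a) <-> (forall t, Y0 t -> tfo t a)).
  move=> [h1 h2]; split=> h.
    by move=> t /h2[s /h hs st]; apply: (iffLR (fo_sat_tfo st)).
  by move=> s /h1[t /h ht st]; apply: (iffRL (fo_sat_tfo st)).
(* The squares needed by the quantifiers: a change at [x] on one side is matched by the same change
   on the other, after which the two assignments correspond at [x] as well. *)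
have sq1 V x (s : assignment M) t s' :
    represents (V `\` [set x]) s t -> pvaries x s s' ->
    exists2 t', varies x t t' & represents V s' t'.
  move=> st [c ->]; exists (upd t x c); first by exists c.
  exact: represents_upd.
have sq2 V x (s : assignment M) t t' :
    represents (V `\` [set x]) s t -> varies x t t' ->
    exists2 s', pvaries x s s' & represents V s' t'.
  move=> st [c ->]; exists (upd s x (Some c)); first by exists c.
  exact: represents_upd.
elim: p X Y => [|t u|R ts|a|n x y|p IHp q IHq|p IHp q IHq|x p IH|x p IH] X Y /= XY.
- exact: lift_set0 XY.
- exact: (flat (FEq t u)) XY.
- exact: (flat (FRel ts)) XY.
- exact: (flat (FNeg a)) XY.
- have [h1 h2] := XY.
  have hx (s : assignment M) t :
      represents [set v | (v \in x) || (v \in y)] s t ->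
      map s x = map Some (map t x) /\ map s y = map Some (map t y).
    by move=> st; split; apply: map_represents => v /= h; apply: st; rewrite /= h ?orbT.
  have inj : injective (map (@Some M)) by apply: inj_map => ? ? [].
  split=> h.
    move=> t /h2[s /h[s' /h1[t' Yt' st']]]  e /hx[ex _].
    exists t' => //; apply: inj; rewrite -ex e.
    by have [_ ->] := hx _ _ st'.
  move=> s /h1[t /h[t' /h2[s' Xs' st']]] e /hx[ex _].
  exists s' => //; rewrite ex e.
  by have [_ ->] := hx _ _ st'.
- by rewrite (IHp X Y) ?(IHq X Y)//; apply: lift_represents_sub XY => v; [right|left].
- have mono V : V `<=` fv p `|` fv q -> forall X0 Y0,
      lift (@represents L M (fv p `|` fv q)) X0 Y0 -> lift (@represents L M V) X0 Y0.
    by move=> ? ? ?; apply: lift_represents_sub.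
  split=> -[X1 [X2 [e h1 h2]]]; rewrite e in XY.
    have [Y1 [Y2 [-> l1 l2]]] := lift_setU XY.
    exists Y1, Y2; split=> //.
      by apply: (iffLR (IHp _ _ _) h1); apply: mono l1 => v; left.
    by apply: (iffLR (IHq _ _ _) h2); apply: mono l2 => v; right.
  have [Y1 [Y2 [-> l1 l2]]] := lift_setU (lift_sym XY).
  exists Y1, Y2; split=> //.
    by apply: (iffRL (IHp _ _ _) h1); apply: mono (lift_sym l1) => v; left.
  by apply: (iffRL (IHq _ _ _) h2); apply: mono (lift_sym l2) => v; right.
- apply: iff_trans (team_sat_Ex X x p) _; split=> -[X' l h].
    have [Y' l1 l2] := lift_square (sq1 _ x) XY l.
    by exists Y' => //; apply: (iffLR (IH _ _ l2)).
  have [Y' l1 l2] := lift_square (fun t s t' => sq2 _ x s t t') (lift_sym XY) l.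
  by exists Y' => //; apply: (iffRL (IH _ _ (lift_sym l2))).
- by rewrite duplicateE; apply: IH; apply: lift_square_image XY; [exact: sq1|exact: sq2].
Qed.

(** * Locality, flatness and substitution *)

Definition agree T (V : set var) (s t : var -> T) := forall v, V v -> s v = t v.

(** Read as a team [X0] of everywhere defined partial assignments, [X] is compared with itself and
    with [Y]; both comparisons are instances of [team_sat_tsat]. *)
Lemma tsat_local L (M : model L) (p : inc L) (X Y : set (var -> M)) :
  lift (agree (fv p)) X Y -> tsat X p <-> tsat Y p.
Proof.
move=> XY; pose X0 := rel_image (fun s s' => s' = Some \o s) X.
have l : lift (fun s s' => s' = Some \o s) X X0.
  by apply: lift_rel_image => s _; exists (Some \o s).
rewrite -(@team_sat_tsat L M p X0 X); last first.
  by split=> [_ [s Xs ->]|s Xs]; [exists s|exists (Some \o s) => //; exists s].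
apply: team_sat_tsat; apply: lift_comp (lift_sym l) XY => _ s t -> st v pv /=.
by rewrite st.
Qed.

Lemma tsat_local1 L (M : model L) (p : inc L) (X Y : set (var -> M)) :
  lift (agree (fv p)) X Y -> tsat X p -> tsat Y p.
Proof. by move=> /tsat_local ->. Qed.

(** Flatness, inherited from [team_sat_fo] through the same everywhere defined team. *)
Lemma tsat_fo L (M : model L) (a : fo L) (X : set (var -> M)) :
  tsat X a <-> forall s, X s -> tfo s a.
Proof.
pose X0 := rel_image (fun s s' => s' = Some \o s) X.
rewrite -(@team_sat_tsat L M a X0 X); last first.
  by split=> [_ [s Xs ->]|s Xs]; [exists s|exists (Some \o s) => //; exists s].
rewrite team_sat_fo; split=> h s.
  move=> Xs; apply/(@fo_sat_tfo L M a (Some \o s)) => //.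
  by apply: h; exists s.
by move=> [t Xt ->]; apply/(@fo_sat_tfo L M a _ t) => //; exact: h.
Qed.

Lemma teval_local L (M : model L) (u : term L) (s t : var -> M) :
  agree (term_fv u) s t -> teval s u = teval t u.
Proof.
elim: u => [x|f ts IH] /= st; first exact: st.
by congr fun_int; apply/funext => i; apply: IH => v vi; apply: st; exists i.
Qed.

Lemma teval_sub L (M : model L) (u : term L) (sg : var -> term L) (s s' : var -> M) :
  (forall v, term_fv u v -> s' v = teval s (sg v)) ->
  teval s (term_sub sg u) = teval s' u.
Proof.
elim: u => [x|f ts IH] /= st; first exact/esym/st.
by congr fun_int; apply/funext => i; apply: IH => v vi; apply: st; exists i.
Qed.

Definition realizes L (M : model L) (sg : var -> term L) (V : set var)
    (s s' : var -> M) := forall v, V v -> s' v = teval s (sg v).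

(** Because the terms put in place of the other variables do not contain [x], their values survive
    the update at [x]. *)
Lemma realizes_upd L (M : model L) sg V x (s s' : var -> M) c :
  (forall v, (V `\` [set x]) v -> ~ term_fv (sg v) x) ->
  realizes sg (V `\` [set x]) s s' ->
  realizes (upd sg x (Var x)) V (upd s x c) (upd s' x c).
Proof.
move=> ff ss' v Vv; have [->|vx] := pselect (v = x); first by rewrite !updE /= updE.
rewrite !updN// ss'//; apply: teval_local => w ww; rewrite updN// => wx.
by apply: (ff v) => //; rewrite -wx.
Qed.

Lemma tfo_sub L (M : model L) (a : fo L) (sg : var -> term L) (s s' : var -> M) :
  fo_free_for sg a -> realizes sg (fo_fv a) s s' ->
  tfo s (fo_sub sg a) <-> tfo s' a.
Proof.
elim: a sg s s' => [|u w|R ts|a IH|a IHa b IHb|a IHa b IHb|x a IH|x a IH] sg s s' //=.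
- by move=> _ h; rewrite !(teval_sub (s' := s'))// => v hv; apply: h; [right|left].
- move=> _ h.
  suff -> : (fun i => teval s (term_sub sg (ts i))) = (fun i => teval s' (ts i)) by [].
  by apply/funext => i; apply: teval_sub => v hv; apply: h; exists i.
- by move=> ff h; rewrite (IH _ _ s').
- by move=> [fa fb] h; rewrite (IHa _ _ s')// 1?(IHb _ _ s')// => v hv; apply: h; [right|left].
- by move=> [fa fb] h; rewrite (IHa _ _ s')// 1?(IHb _ _ s')// => v hv; apply: h; [right|left].
- move=> [fx fa] h; have ux c := realizes_upd c fx h.
  by split=> -[c hc]; exists c; [apply: (iffLR (IH _ _ _ fa (ux c)))|
    apply: (iffRL (IH _ _ _ fa (ux c)))].
- move=> [fx fa] h; have ux c := realizes_upd c fx h.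
  by split=> hc c; [apply: (iffLR (IH _ _ _ fa (ux c)))|
    apply: (iffRL (IH _ _ _ fa (ux c)))].
Qed.

Lemma lift_realizes_sub L (M : model L) sg V W (X Y : set (var -> M)) :
  V `<=` W -> lift (realizes sg W) X Y -> lift (realizes sg V) X Y.
Proof.
move=> VW [h1 h2]; split=> [s /h1[t Yt st]|t /h2[s Xs st]].
  by exists t => // v /VW /st.
by exists s => // v /VW /st.
Qed.

Lemma tsat_sub L (M : model L) (p : inc L) sg (X Y : set (var -> M)) :
  free_for sg p -> lift (realizes sg (fv p)) X Y ->
  tsat X (sub sg p) <-> tsat Y p.
Proof.
have flat (a : fo L) sg' (X0 Y0 : set (var -> M)) : fo_free_for sg' a ->
    lift (realizes sg' (fo_fv a)) X0 Y0 ->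
    ((forall s, X0 s -> tfo s (fo_sub sg' a)) <-> (forall t, Y0 t -> tfo t a)).
  move=> ff [h1 h2]; split=> h.
    by move=> t /h2[s /h hs st]; apply: (iffLR (tfo_sub ff st)).
  by move=> s /h1[t /h ht st]; apply: (iffRL (tfo_sub ff st)).
elim: p sg X Y => [|t u|R ts|a|n x y|p IHp q IHq|p IHp q IHq|x p IH|x p IH] sg X Y /=.
- by move=> _; exact: lift_set0.
- exact: (flat (FEq t u)).
- exact: (flat (FRel ts)).
- exact: (flat (FNeg a)).
- move=> ff [h1 h2].
  (* By [free_for], every variable of the atom is sent to a variable, so [var_sub] does not fall
     into its default branch. *)
  have hx (s s' : var -> M) :
      realizes sg [set v | (v \in x) || (v \in y)] s s' ->
      map s (map (var_sub sg) x) = map s' x /\ map s (map (var_sub sg) y) = map s' y.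
    move=> st; split; rewrite -map_comp; apply/eq_in_map => v vx;
      have vxy : (v \in x) || (v \in y) by rewrite vx ?orbT.
      by have [w e] := ff v vxy; rewrite /= /var_sub (st v)// e.
    by have [w e] := ff v vxy; rewrite /= /var_sub (st v)// e.
  split=> h.
    move=> t /h2[s /h[s' /h1[t' Yt' st']]] /= e /hx[ex _].
    by exists t' => //; rewrite -ex e; have [_ ->] := hx _ _ st'.
  move=> s /h1[t /h[t' /h2[s' Xs' st']]] e /hx[ex _].
  by exists s' => //=; rewrite ex e; have [_ ->] := hx _ _ st'.
- move=> [fp fq] XY.
  by rewrite (IHp _ X Y) ?(IHq _ X Y)//; apply: lift_realizes_sub XY => v; [right|left].
- move=> [fp fq].
  have mono V : V `<=` fv p `|` fv q -> forall X0 Y0,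
      lift (@realizes L M sg (fv p `|` fv q)) X0 Y0 -> lift (realizes sg V) X0 Y0.
    by move=> ? ? ?; apply: lift_realizes_sub.
  move=> XY; split=> -[X1 [X2 [e h1 h2]]]; rewrite e in XY.
    have [Y1 [Y2 [-> l1 l2]]] := lift_setU XY.
    exists Y1, Y2; split=> //.
      by apply: (iffLR (IHp _ _ _ fp _) h1); apply: mono l1 => v; left.
    by apply: (iffLR (IHq _ _ _ fq _) h2); apply: mono l2 => v; right.
  have [Y1 [Y2 [-> l1 l2]]] := lift_setU (lift_sym XY).
  exists Y1, Y2; split=> //.
    by apply: (iffRL (IHp _ _ _ fp _) h1); apply: mono (lift_sym l1) => v; left.
  by apply: (iffRL (IHq _ _ _ fq _) h2); apply: mono (lift_sym l2) => v; right.
- move=> [fx fp] XY.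
  split=> -[X' l h].
    have [|Y' l1 l2] := lift_square (T := varies x)
        (R' := realizes (upd sg x (Var x)) (fv p)) _ XY l.
      move=> s t _ st [c ->]; exists (upd t x c); first by exists c.
      exact: realizes_upd.
    by exists Y' => //; apply: (iffLR (IH _ _ _ fp l2)).
  have [|Y' l1 l2] := lift_square (T := varies x)
      (R' := fun t s => realizes (upd sg x (Var x)) (fv p) s t) _ (lift_sym XY) l.
    move=> s t _ st [c ->]; exists (upd t x c); first by exists c.
    exact: realizes_upd.
  by exists Y' => //; apply: (iffRL (IH _ _ _ fp (lift_sym l2))).
- move=> [fx fp] XY; apply: IH => //; apply: lift_square_image XY.
    move=> s t _ st [c ->]; exists (upd t x c); first by exists c.
    exact: realizes_upd.
  move=> s t _ st [c ->]; exists (upd s x c); first by exists c.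
  exact: realizes_upd.
Qed.

Lemma tsat_sub1 L (M : model L) (p : inc L) x t (X : set (var -> M)) :
  free_for (sub1 x t) p ->
  tsat X (sub (sub1 x t) p) <-> tsat [set upd s x (teval s t) | s in X] p.
Proof.
move=> ff; apply: tsat_sub => //.
have r s : realizes (sub1 x t) (fv p) s (upd s x (teval s t)).
  by move=> v _; rewrite /sub1 /upd; case: eqP.
by split=> [s Xs|_ [s Xs <-]]; [exists (upd s x (teval s t)) => //; exists s|exists s].
Qed.

Lemma tfo_local L (M : model L) (a : fo L) (s t : var -> M) :
  agree (fo_fv a) s t -> tfo s a <-> tfo t a.
Proof.
move=> st; rewrite -(@fo_sat_tfo L M a (Some \o s) s)//.
by apply: fo_sat_tfo => v /st /= ->.
Qed.

(** * Free variables, the empty team and unions of teams *)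

Lemma fo_fv_occ L (a : fo L) : fo_fv a `<=` fo_occ a.
Proof.
elim: a => [|t u|R ts|a IH|a IHa b IHb|a IHa b IHb|x a IH|x a IH] //=.
- exact: setUSS.
- exact: setUSS.
- by move=> v [/IH]; left.
- by move=> v [/IH]; left.
Qed.

Lemma fv_occ L (p : inc L) : fv p `<=` occ p.
Proof.
elim: p => [|t u|R ts|a|n x y|p IHp q IHq|p IHp q IHq|x p IH|x p IH] //=.
- exact: fo_fv_occ.
- exact: setUSS.
- exact: setUSS.
- by move=> v [/IH]; left.
- by move=> v [/IH]; left.
Qed.

Lemma rel_image_setU A B (R : A -> B -> Prop) X Y :
  rel_image R (X `|` Y) = rel_image R X `|` rel_image R Y.
Proof.
apply/seteqP; split=> b; first by move=> [a [Xa|Ya] ?]; [left|right]; exists a.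
by move=> [[a ? ?]|[a ? ?]]; exists a => //; [left|right].
Qed.

Lemma lift_setUU A B (R : A -> B -> Prop) X Y X' Y' :
  lift R X X' -> lift R Y Y' -> lift R (X `|` Y) (X' `|` Y').
Proof.
move=> [h1 h2] [k1 k2]; split=> [a [/h1|/k1]|b [/h2|/k2]] [c ? ?];
  by exists c => //; by [left|right].
Qed.

(** A converse to [lift_comp], used to peel one quantifier off a string. The middle set consists of
    all points lying between a member of [X] and a member of [Z]. *)
Lemma lift_factor A B C (R : A -> B -> Prop) (S : B -> C -> Prop)
    (T : A -> C -> Prop) X Z :
  (forall a c, T a c -> exists2 b, R a b & S b c) ->
  lift T X Z -> exists2 Y, lift R X Y & lift S Y Z.
Proof.
move=> TRS [TXZ TZX].
exists [set b | exists a c, [/\ X a, Z c, R a b & S b c]]; split.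
- move=> a Xa; have [c Zc /TRS[b Rab Sbc]] := TXZ a Xa.
  by exists b => //; exists a, c.
- by move=> b [a [c [Xa _ Rab _]]]; exists a.
- by move=> b [a [c [_ Zc _ Sbc]]]; exists c.
- move=> c Zc; have [a Xa /TRS[b Rab Sbc]] := TZX c Zc.
  by exists b => //; exists a, c.
Qed.

(** The empty team property, on which ex falso and disjunction introduction rest. *)
Lemma tsat_set0 L (M : model L) (p : inc L) : tsat (@set0 (var -> M)) p.
Proof.
elim: p => [|t u|R ts|a|n x y|p IHp q IHq|p IHp q IHq|x p IH|x p IH] //=.
- by exists set0, set0; rewrite setU0.
- by exists set0.
- suff -> : rel_image (varies x) (@set0 (var -> M)) = set0 by [].
  by rewrite -subset0 => t [].
Qed.

(** Witnesses for the two teams are united clause by clause; a witness for an inclusion atom remains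
    available in the larger team. *)
Lemma tsat_setU L (M : model L) (p : inc L) (X Y : set (var -> M)) :
  tsat X p -> tsat Y p -> tsat (X `|` Y) p.
Proof.
elim: p X Y => [|t u|R ts|a|n x y|p IHp q IHq|p IHp q IHq|x p IH|x p IH] X Y /=.
- by move=> -> ->; rewrite setU0.
- by move=> hX hY s [/hX|/hY].
- by move=> hX hY s [/hX|/hY].
- by move=> hX hY s [/hX|/hY].
- by move=> hX hY s [/hX|/hY] [s' ? ?]; exists s' => //; [left|right].
- by move=> [? ?] [? ?]; split; [apply: IHp|apply: IHq].
- move=> [X1 [X2 [-> ? ?]]] [Y1 [Y2 [-> ? ?]]].
  by exists (X1 `|` Y1), (X2 `|` Y2); split; [rewrite setUACA|apply: IHp|apply: IHq].
- move=> [X' lX hX] [Y' lY hY]; exists (X' `|` Y'); first exact: lift_setUU.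
  exact: IH.
- by move=> hX hY; rewrite rel_image_setU; apply: IH.
Qed.

(** * Strings of quantifiers *)

Definition off T (x : seq var) : (var -> T) -> (var -> T) -> Prop :=
  agree [set v | v \notin x].

Lemma off_nil T (s t : var -> T) : off [::] s t -> s = t.
Proof. by move=> h; apply/funext => v; apply: h. Qed.

Lemma off_cons T x xs (s t u : var -> T) :
  varies x s t -> off xs t u -> off (x :: xs) s u.
Proof.
move=> [c ->] h v; rewrite /= inE negb_or => /andP[/eqP vx /h <-].
by rewrite updN.
Qed.

Lemma off_consE T x xs (s u : var -> T) :
  off (x :: xs) s u -> exists2 t, varies x s t & off xs t u.
Proof.
move=> h; exists (upd s x (u x)); first by exists (u x).
move=> v /= vxs; have [->|vx] := eqVneq v x; first by rewrite updE.
by rewrite updN; [apply: h; rewrite /= inE negb_or vx|apply/eqP].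
Qed.

Lemma tsat_Exs L (M : model L) (X : set (var -> M)) xs p :
  tsat X (Exs xs p) <-> exists2 X', lift (off xs) X X' & tsat X' p.
Proof.
elim: xs X => [|x xs IH] X /=.
  split=> [h|[X' [h1 h2]]]; first by exists X => //; split=> s; exists s.
  suff -> : X = X' by [].
  by apply/seteqP; split=> s => [/h1|/h2] [t ? /off_nil] => [->|<-].
split=> [[X1 l1 /IH[X' l2 h]]|[X' l h]].
  by exists X' => //; apply: lift_comp l1 l2; exact: off_cons.
have [X1 l1 l2] := lift_factor (@off_consE M x xs) l.
by exists X1 => //; apply/IH; exists X'.
Qed.

Lemma tsat_Alls L (M : model L) (X : set (var -> M)) xs p :
  tsat X (Alls xs p) <-> tsat (rel_image (off xs) X) p.
Proof.
elim: xs X => [|x xs IH] X /=.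
  suff -> : rel_image (off [::]) X = X by [].
  by apply/seteqP; split=> [s [t Xt /off_nil <-]|s Xs] //; exists s.
rewrite IH; suff -> : rel_image (off xs) (rel_image (varies x) X)
    = rel_image (off (x :: xs)) X by [].
apply/seteqP; split=> t.
  by move=> [s1 [s Xs s1x] s1t]; exists s => //; apply: off_cons s1x s1t.
by move=> [s Xs /off_consE[s1 h1 h2]]; exists s1 => //; exists s.
Qed.

(** * Vacuous quantification, and universal quantifiers extended over a disjunction *)

Lemma varies_agree T (V : set var) x (X Y : set (var -> T)) :
  ~ V x -> lift (varies x) X Y -> lift (agree V) X Y.
Proof.
move=> Vx; have a (s t : var -> T) : varies x s t -> agree V s t.
  by move=> [c ->] v Vv; rewrite updN// => vx; rewrite vx in Vv.
by move=> [h1 h2]; split=> [s /h1|s /h2] [t ? /a]; exists t.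
Qed.

Lemma lift_All T (X : set (var -> T)) x :
  lift (varies x) X (rel_image (varies x) X).
Proof. by apply: lift_rel_image => s _; exists s; exact: varies_refl. Qed.

(** Whether [y = z] holds marks the disjunct to which an assignment belongs. As [x] differs from [y]
    and [z], all variants of an assignment at [x] carry the same mark, so they are sent to the same
    disjunct together. *)
Lemma tsat_or_ext L (M : model L) (X : set (var -> M)) x y z p q :
  or_ext_side x y z p q -> tsat X (Or (All x p) q) <-> tsat X (or_ext x y z p q).
Proof.
move=> [qx yz hy hz].
have [py qy yx] : [/\ ~ fv p y, ~ fv q y & y <> x].
  by split=> h; apply: hy; [left; left; exact: fv_occ|right; exact: fv_occ|left; right].
have [pz qz zx] : [/\ ~ fv p z, ~ fv q z & z <> x].
  by split=> h; apply: hz; [left; left; exact: fv_occ|right; exact: fv_occ|left; right].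
rewrite -[or_ext x y z p q]/(Exs [:: y; z] _) tsat_Exs /=.
have offyz (s : var -> M) c d : off [:: y; z] s (upd (upd s y c) z d).
  move=> v /=; rewrite !inE negb_or => /andP[/eqP vy /eqP vz].
  by rewrite !updN.
have valy (s : var -> M) c d b : upd (upd (upd s y c) z d) x b y = c.
  by rewrite updN// updN// updE.
have valz (s : var -> M) c d b : upd (upd (upd s y c) z d) x b z = d.
  by rewrite updN// updE.
have fresh V (s t : var -> M) c : ~ V y -> ~ V z -> off [:: y; z] s t ->
    agree V (upd s x c) (upd t x c).
  move=> Vy Vz st v Vv; have [->|vx] := pselect (v = x); first by rewrite !updE.
  rewrite !updN//; apply: st; rewrite /= !inE negb_or.
  by apply/andP; split; apply/eqP => e; rewrite e in Vv.
split=> [[Y [Z [-> hY hZ]]]|[X' [l1 l2] [Y' [Z' [e [pY eY] [qZ eZ]]]]]].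
  (* Two distinct elements encode the mark: the pair [a], [a] for the left part and [a], [b] for the
     right one. *)
  have [a [b ab]] := two_elements M.
  pose Y1 := [set upd (upd s y a) z a | s in Y].
  pose Z1 := [set upd (upd s y a) z b | s in Z].
  have lY : lift (off [:: y; z]) Y Y1.
    by split=> [s Ys|_ [s Ys <-]]; [exists (upd (upd s y a) z a) => //; exists s|exists s].
  have lZ : lift (off [:: y; z]) Z Z1.
    by split=> [s Ys|_ [s Ys <-]]; [exists (upd (upd s y a) z b) => //; exists s|exists s].
  exists (Y1 `|` Z1); first exact: lift_setUU.
  rewrite rel_image_setU; do 2!eexists; split; first by [].
    split.
      apply: tsat_local1 hY; apply: lift_square_image lY.
        by move=> s t _ st [c ->]; exists (upd t x c); [exists c|exact: fresh].
      by move=> s t _ st [c ->]; exists (upd s x c); [exists c|exact: fresh].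
    move=> _ [_ [s _ <-] [c ->]] /=.
    by rewrite valy valz.
  split.
    apply: tsat_local1 hZ; apply: (@lift_comp _ _ _ (agree (fv q)) (agree (fv q)) _ _ Z1);
      last exact: varies_agree (lift_All _ _).
      by move=> s t u st tu v qv; rewrite st// tu.
    split=> [s /lZ.1[t Zt st]|t /lZ.2[s Zs st]]; [exists t|exists s] => // v qv;
      by apply: st; rewrite /= !inE negb_or; apply/andP; split; apply/eqP => e; rewrite e in qv.
  move=> _ [_ [s _ <-] [c ->]] /=.
  by rewrite valy valz.
have updyz (t : var -> M) c : (upd t x c y = upd t x c z) = (t y = t z).
  by rewrite !updN.
(* The team is split according to the marks in [X']; an assignment extended there with both marks
   goes to both parts. *)
exists [set s | X s /\ exists2 t, X' t & off [:: y; z] s t /\ t y = t z],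
  [set s | X s /\ exists2 t, X' t & off [:: y; z] s t /\ t y <> t z]; split.
- apply/seteqP; split=> s => [Xs|[[]|[]]] //.
  have [t Xt st] := l1 s Xs.
  by case: (pselect (t y = t z)) => h; [left|right]; split=> //; exists t.
- apply: tsat_local1 pY; split=> [t' Yt'|_ [s [Xs [t Xt [st tyz]]] [c ->]]].
    have : rel_image (varies x) X' t' by rewrite e; left.
    move=> [t Xt [c et]]; have [s Xs st] := l2 t Xt.
    exists (upd s x c); last by rewrite et => v /(fresh _ _ _ c py pz st).
    exists s; last by exists c.
    by split=> //; exists t => //; split=> //; rewrite -(updyz t c) -et; exact: eY.
  exists (upd t x c); last by move=> v /(fresh _ _ _ c py pz st).
  have : rel_image (varies x) X' (upd t x c) by exists t => //; exists c.
  by rewrite e => -[//|/eZ /=]; rewrite updyz.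
- have ag (s t : var -> M) c : off [:: y; z] s t -> agree (fv q) (upd t x c) s.
    move=> st v qv; rewrite -(fresh _ _ _ c qy qz st)// updN// => vx.
    by rewrite vx in qv.
  apply: tsat_local1 qZ; split=> [t' Zt'|s [Xs [t Xt [st tyz]]]].
    have : rel_image (varies x) X' t' by rewrite e; right.
    move=> [t Xt [c et]]; have [s Xs st] := l2 t Xt.
    exists s; last by rewrite et; exact: ag.
    by split=> //; exists t => //; split=> //; rewrite -(updyz t c) -et; exact: eZ.
  (* Since [x] is not free in [q], a single variant of [t] suffices, and [t x] itself serves as its
     value. *)
  have : rel_image (varies x) X' (upd t x (t x)) by exists t => //; exists (t x).
  rewrite e => -[/eY /=|Zt]; first by rewrite updyz.
  by exists (upd t x (t x)) => //; exact: ag.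
Qed.

(** * Simultaneous updates, and the simulation of universal quantifiers by inclusion atoms *)

Definition upds T (s : var -> T) (x : seq var) (l : seq T) : var -> T :=
  fun v => nth (s v) l (index v x).

(** Outside [x] the index equals the length of [x], which is past the end of [l], so [nth] returns
    its default [s v]. *)
Lemma upds_off T (s : var -> T) x l : size l = size x -> off x s (upds s x l).
Proof.
by move=> e v /= vx; rewrite /upds nth_default// e leqNgt index_mem.
Qed.

Lemma map_upds T (s : var -> T) x l :
  uniq x -> size l = size x -> map (upds s x l) x = l.
Proof.
move=> ux e; apply: (@eq_from_nth _ (s 0)); rewrite size_map// => i ix.
rewrite (nth_map 0)// /upds index_uniq//.
by apply: set_nth_default; rewrite e.
Qed.

Lemma map_off T (s t : var -> T) (x y : seq var) :
  off x s t -> (forall v, v \in y -> v \notin x) -> map s y = map t y.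
Proof. by move=> st yx; apply/eq_in_map => v /yx /st. Qed.

(** With [y] universally quantified, the atom says that for each value of [z] in the team, every
    tuple occurs as a value of [x] alongside it. As the free variables of [p] are among [x] and [z],
    such a team is as good for [p] as the one with all variants at [x]. *)
Lemma tsat_sim L (M : model L) (X : set (var -> M)) n m
    (x y : n.-tuple var) (z : m.-tuple var) (p : inc L) :
  sim_side x y z p -> tsat X (Alls x p) <-> tsat X (sim x y z p).
Proof.
move=> [[ux uy xz fvp] hy].
have yp v : v \in y -> ~ fv p v by move=> /hy[h _] /fv_occ.
have zx v : v \in z -> v \notin x by move=> vz; apply/negP => /xz; rewrite vz.
have zy v : v \in z -> v \notin y.
  by move=> vz; apply/negP => /hy[_]; rewrite mem_cat vz orbT.
have xy v : v \in x -> v \notin y.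
  by move=> vx; apply/negP => /hy[_]; rewrite mem_cat vx.
have yx v : v \in y -> v \notin x by move=> vy; apply/negP => /xy; rewrite vy.
have offp (s t : var -> M) : off y s t -> agree (fv p) s t.
  by move=> st v pv; apply: st; apply/negP => /yp.
rewrite tsat_Alls tsat_Exs.
have size_xy (s : var -> M) : size (map s y) = size x by rewrite size_map !size_tuple.
have size_yx (s : var -> M) : size (map s x) = size y by rewrite size_map !size_tuple.
split=> [h|[X' [l1 l2] /tsat_Alls[/= hI hp]]].
  exists (rel_image (off x) X).
    by apply: lift_rel_image => s _; exists s.
  apply/tsat_Alls; split=> /=.
    move=> t [t1 [s Xs st1] t1t].
    have o := upds_off t1 (size_xy t).
    (* The values of [y] are copied to [x]; the result stays in the team, which contains all
       variants at [x]. *)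
    exists (upds t1 x (map t y)).
      exists (upds t1 x (map t y)) => //; exists s => //.
      by move=> v vx; rewrite st1// o.
    apply/eq_map_cat => //; split; last by rewrite map_upds.
    by rewrite -(map_off t1t)// (map_off o).
  apply: tsat_local1 h; split=> [t Xt|t [t1 Xt1 t1t]].
    by exists t => //; exists t.
  by exists t1 => //; exact: offp.
apply: tsat_local1 hp; split=> [t [t1 Xt1 t1t]|t [s Xs st]].
  have [s Xs st] := l2 t1 Xt1; exists t1; first by exists s.
  by move=> v /(offp _ _ t1t).
have [t1 Xt1 st1] := l1 s Xs; have o := upds_off t1 (size_yx t).
(* Giving [y] the values that [t] has on [x] makes the atom return an assignment agreeing with [t]
   on both [x] and [z]. *)
have [|t' Yt' /eq_map_cat[]] := hI (upds t1 y (map t x)); first by exists t1.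
  by [].
rewrite map_upds// -(map_off o)// -(map_off st1)// (map_off st)// => ez ex.
exists t' => // v /fvp; rewrite mem_cat => /orP[vx|vz].
  by have /eq_in_map/(_ v vx) := ex.
by have /eq_in_map/(_ v vz) := ez.
Qed.

(** * Inclusion atoms extended by a pair of variables that records a first-order formula *)

Lemma tsat_Ands L (M : model L) (X : set (var -> M)) (I : eqType) (r : seq I)
    (f : I -> inc L) p :
  tsat X (Ands [seq f i | i <- r] p) <->
  (forall i, i \in r -> tsat X (f i)) /\ tsat X p.
Proof.
elim: r => [|i r IH] /=; first by split=> [|[]].
rewrite IH; split=> [[fi [fr hp]]|[fr hp]].
  by split=> // j; rewrite inE => /orP[/eqP->|/fr].
by split; [|split=> // j jr]; apply: fr; rewrite inE ?eqxx ?jr ?orbT.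
Qed.

(* The assignments supporting the right disjunct are made constant on [x],
   so that each of them witnesses the inclusion atoms for itself. *)
Lemma tsat_ex_incl_ext L (M : model L) (X : set (var -> M)) (x : seq var)
    (u v : var) k (n : 'I_k -> nat) (rho sigma : forall i : 'I_k, (n i).-tuple var)
    (a : fo L) p :
  (forall i w, (w \in rho i) || (w \in sigma i) -> w \in x) ->
  (forall w, w \in x -> ~ fv p w) ->
  u <> v ->
  (forall w, w = u \/ w = v -> [/\ w \notin x, ~ fo_fv a w & ~ fv p w]) ->
  tsat X (Or (Exs x (Ands [seq Incl (rho i) (sigma i) | i <- enum 'I_k] a)) p) ->
  tsat X (Exs x (Ex u (Ex v
    (Ands [seq Incl (cat_tuple (rho i) [tuple u; v])
                    (cat_tuple (sigma i) [tuple u; v]) | i <- enum 'I_k]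
          (And (FIff a (FEq (Var u) (Var v))) (Or a p)))))).
Proof.
move=> rsx xp uv uvf [Y [Z [-> /tsat_Exs[Y' lY /tsat_Ands[hI ha]] hZ]]].
have [ux ua up] := uvf u (or_introl erefl).
have [vx va vp] := uvf v (or_intror erefl).
have [c [d cd]] := two_elements M.
move/tsat_fo in ha.
pose ext (t : var -> M) b e := upd (upd t u b) v e.
have extu t b e : ext t b e u = b by rewrite /ext updN// updE.
have extv t b e : ext t b e v = e by rewrite /ext updE.
have extx t b e w : w \in x -> ext t b e w = t w.
  move=> wx; rewrite /ext !updN// => ew; [move: ux|move: vx]; by rewrite -ew wx.
have extm t b e (r : seq var) : (forall w, w \in r -> w \in x) ->
    map (ext t b e) r = map t r.
  by move=> rx; apply/eq_in_map => w /rx /extx ->.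
have exta t b e : tfo (ext t b e) a <-> tfo t a.
  by apply: tfo_local => w aw; rewrite /ext !updN// => ew; rewrite ew in aw.
have extoff (s t : var -> M) b e : off x s t -> off (x ++ [:: u; v]) s (ext t b e).
  move=> st w; rewrite /= mem_cat !inE !negb_or => /and3P[wx /eqP wu /eqP wv].
  by rewrite /ext !updN// st.
pose g s := upds s x (nseq (size x) c).
have goff s : off x s (g s) by apply: upds_off; rewrite size_nseq.
have gx s w : w \in x -> g s w = c.
  by move=> wx; rewrite /g /upds nth_nseq index_mem wx.
(* The value of [v] records whether [a] holds at [g s], which secures the biconditional even where
   [a] happens to hold on the right part. *)
pose h s := ext (g s) c (if `[< tfo (g s) a >] then c else d).
pose Y1 := [set ext t c c | t in Y']; pose Z1 := [set h s | s in Z].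
rewrite -[Ex u _]/(Exs [:: u; v] _) /Exs -foldr_cat -/(Exs _ _).
apply/tsat_Exs; exists (Y1 `|` Z1).
  apply: lift_setUU.
    split=> [s /lY.1[t Yt st]|_ [t Yt <-]].
      by exists (ext t c c); [exists t|exact: extoff].
    by have [s Ys st] := lY.2 t Yt; exists s => //; exact: extoff.
  by split=> [s Zs|_ [s Zs <-]]; [exists (h s); [exists s|]|exists s]; rewrite // /h; exact: extoff.
apply/tsat_Ands; split=> [i _ /= s0|].
  have rx w : w \in rho i -> w \in x by move=> wr; apply: (rsx i); rewrite wr.
  have sx w : w \in sigma i -> w \in x by move=> wr; apply: (rsx i); rewrite wr orbT.
  have ssz : size (rho i) = size (sigma i) by rewrite !size_tuple.
  move=> [[t Yt <-]|[s Zs <-]].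
    (* On the left part [u] and [v] are constantly [c], so the witness for the original atom also
       serves for the extended one. *)
    have [t' Yt' e] := hI i (mem_enum _ i) t Yt.
    exists (ext t' c c); first by left; exists t'.
    apply/eq_map_cat => //; split; last by rewrite /= !extu !extv.
    by rewrite !extm.
  exists (h s); first by right; exists s.
  apply/eq_map_cat => //; split=> //.
  have cst (r : seq var) : (forall w, w \in r -> w \in x) -> map (h s) r = nseq (size r) c.
    move=> rx'; have <- : map (fun=> c) r = nseq (size r) c by elim: (r) => //= _ ? ->.
    by rewrite /h extm//; apply/eq_in_map => w /rx' /gx ->.
  by rewrite !cst// ssz.
split.
  apply/tsat_fo => _ [[t /ha hat <-]|[s _ <-]] /=; rewrite ?extu ?extv.
    by rewrite exta; split; [right|right].
  rewrite /h exta extu extv; case: asboolP => ht; first by split; [right|right].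
  by split; left.
exists Y1, Z1; split=> //.
  by apply/tsat_fo => _ [t /ha hat <-]; apply/exta.
apply: tsat_local1 hZ.
have ag s : agree (fv p) s (h s).
  move=> w pw; apply: (extoff s) (goff s) _ _; rewrite /= mem_cat !inE !negb_or.
  by apply/and3P; split; [apply/negP => /xp|apply/eqP => e|apply/eqP => e]; rewrite ?e in pw.
by split=> [s Zs|_ [s Zs <-]]; [exists (h s) => //; exists s|exists s].
Qed.

(** * Soundness of the rules over total assignments *)

Lemma tfo_subs L (M : model L) n (x y z : n.-tuple var) (a : fo L)
    (s t : var -> M) :
  (forall v, fo_fv a v -> v \in z) ->
  fo_free_for (subs z x) a -> fo_free_for (subs z y) a ->
  map s y = map t x ->
  tfo s (fo_sub (subs z y) a) <-> tfo t (fo_sub (subs z x) a).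
Proof.
(* Both instances amount to [a] evaluated at [s'], which gives each variable of [z] the common value
   of the corresponding entries of [y] under [s] and of [x] under [t]. *)
move=> az fx fy e; pose s' v := s (nth v y (index v z)).
rewrite (tfo_sub (s' := s') fy)// (tfo_sub (s' := s') fx)// => v /az vz.
have iz : index v z < n by rewrite -[X in _ < X](size_tuple z) index_mem.
rewrite /s' /subs /=.
by rewrite -!(nth_map v (s v))/= ?size_tuple// e.
Qed.

Lemma deriv_tsat L (A : set (inc L)) (p : inc L) :
  deriv A p -> forall (M : model L) (X : set (var -> M)),
  (forall q, A q -> tsat X q) -> tsat X p.
Proof.
have flat (M : model L) (B : set (inc L)) (X Y : set (var -> M)) :
    first_order B -> Y `<=` X ->
    (forall q, B q -> tsat X q) -> forall q, B q -> tsat Y q.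
  move=> foB YX h q Bq; have [a e] := foB q Bq; move: (h q Bq).
  by rewrite e !tsat_fo => ha s /YX /ha.
have addA (M : model L) (X : set (var -> M)) (B : set (inc L)) r :
    (forall q, B q -> tsat X q) -> tsat X r ->
    forall q, (B `|` [set r]) q -> tsat X q.
  by move=> hB hr q [/hB|->].
(* The subderivation is applied to the singleton team of an assignment satisfying [b]. By flatness
   this team inherits the side assumptions [B], so it would have to be empty. *)
have refute (M : model L) (B : set (inc L)) (X : set (var -> M)) (b : fo L) :
    first_order B -> (forall q, B q -> tsat X q) ->
    (forall Y : set (var -> M),
      (forall q, (B `|` [set (b : inc L)]) q -> tsat Y q) -> Y = set0) ->
    forall s, X s -> ~ tfo s b.
  move=> foB hB ih s Xs sb.
  have : [set s] = set0.
    apply: ih; apply: addA; first by apply: flat hB => // _ ->.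
    by apply/tsat_fo => _ ->.
  by move/seteqP => [/(_ s erefl)].
elim=> {A p}.
- by move=> A p Ap M X; apply.
- by move=> A t M X _ s Xs.
- move=> A t t' x p ff ff' _ IHe _ IHp M X hA.
  have /= he := IHe M X hA; have /(tsat_sub1 _ ff) := IHp M X hA.
  move=> hp; apply/(tsat_sub1 _ ff').
  suff <- : [set upd s x (teval s t) | s in X] = [set upd s x (teval s t') | s in X] by [].
  by apply: eq_imagel => s /he ->.
- move=> A B a BA foB _ IH M X hA /=.
  by apply: (refute M B) => // [q /BA /hA //|Y]; exact: IH.
- move=> A a p _ IH1 _ IH2 M X hA.
  have /tsat_fo h1 := IH1 M X hA; have /= h2 := IH2 M X hA.
  suff -> : X = set0 by exact: tsat_set0.
  by rewrite -subset0 => s Xs; apply: (h2 s Xs); exact: h1.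
- move=> A B a BA foB _ IH M X hA.
  apply/tsat_fo => s Xs; apply: contrapT => na.
  by apply: (refute M B X (FNeg a)) Xs na => // [q /BA /hA //|Y]; exact: IH.
- by move=> A p q _ IHp _ IHq M X hA; split; [exact: IHp|exact: IHq].
- by move=> A p q _ IH M X hA; have [] := IH M X hA.
- by move=> A p q _ IH M X hA; have [] := IH M X hA.
- move=> A p q _ IH M X hA; exists X, set0; rewrite setU0; split=> //; first exact: IH.
  exact: tsat_set0.
- move=> A p q _ IH M X hA; exists set0, X; rewrite set0U; split=> //; last exact: IH.
  exact: tsat_set0.
- move=> A B p q r BA foB _ IH _ IHp _ IHq M X hA.
  have [Y [Z [e hp hq]]] := IH M X hA; rewrite e.
  have hB r' : B r' -> tsat X r' by move=> /BA /hA.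
  (* Each part inherits the first-order side assumptions and so satisfies [r]; union closure puts
     the parts together again. *)
  by apply: tsat_setU; [apply: IHp|apply: IHq]; apply: addA => //;
    apply: flat hB => //; rewrite e => s; [left|right].
- move=> A x t p ff _ IH M X hA; have /(tsat_sub1 _ ff) h := IH M X hA.
  exists [set upd s x (teval s t) | s in X] => //.
  split=> [s Xs|_ [s Xs <-]]; last by exists s => //; exists (teval s t).
  by exists (upd s x (teval s t)); [exists s|exists (teval s t)].
- move=> A B x p q BA xB qx _ IH1 _ IH2 M X hA.
  have [X' l hp] := IH1 M X hA.
  apply/(tsat_local (varies_agree qx l)); apply: IH2; apply: addA => // r Br.
  by apply/(tsat_local (varies_agree (xB r Br) l)); exact/hA/BA.
- move=> A B x p BA xB _ IH M X hA /=; apply: IH => r Br.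
  by apply/(tsat_local (varies_agree (xB r Br) (lift_All X x))); exact/hA/BA.
- move=> A x t a ff _ IH M X hA; have /= /tsat_fo h := IH M X hA.
  apply/tsat_fo => s Xs; apply/(tfo_sub (s' := upd s x (teval s t)) ff).
    by move=> v _; rewrite /sub1 /upd; case: eqP.
  by apply: h; exists s => //; exists (teval s t).
- move=> A x p px _ IH M X hA; have /= h := IH M X hA.
  by apply/(tsat_local (varies_agree px (lift_All X x))).
- move=> A B x y p q BA yB py ff _ IH1 _ IH2 M X hA /=.
  have /= hp := IH1 M X hA; apply: IH2; apply: addA.
    by move=> r Br; apply/(tsat_local (varies_agree (yB r Br) (lift_All X y))); exact/hA/BA.
  apply: (iffRL (tsat_sub ff _) hp).
  (* Substituting [y] for [x] after an update at [y] has the effect on [p] of the same update at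
     [x], because [y] is not free in the universal formula. *)
  have r s c : realizes (sub1 x (Var y)) (fv p) (upd s y c) (upd s x c).
    move=> v pv; have [->|vx] := pselect (v = x).
      by rewrite /sub1 !updE /= updE.
    rewrite /sub1 !updN//= updN// => vy; apply: py; rewrite -vy.
    by split.
  split=> _ [s Xs [c ->]].
    by exists (upd s x c) => //; exists s => //; exists c.
  by exists (upd s y c) => //; exists s => //; exists c.
- move=> A x y p _ IH M X hA /=; have /= := IH M X hA.
  have [->//|xy] := eqVneq x y.
  suff -> : rel_image (varies y) (rel_image (varies x) X) =
            rel_image (varies x) (rel_image (varies y) X) by [].
  have updC (s : var -> M) c d : upd (upd s x c) y d = upd (upd s y d) x c.
    apply/funext => v; rewrite /upd; case: (eqVneq v y) => // ->.
    by rewrite eq_sym (negbTE xy).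
  apply/seteqP; split=> _ [_ [s Xs [c ->]] [d ->]].
    by rewrite updC; exists (upd s y d); [exists s => //; exists d|exists c].
  by rewrite -updC; exists (upd s x d); [exists s => //; exists d|exists c].
- by move=> A x p q _ IH1 _ IH2 M X hA; split; [exact: IH1|exact: IH2].
- by move=> A x y z p q side _ IH M X hA; apply/(tsat_or_ext X side); exact: IH.
- by move=> A x y z p q side _ IH M X hA; apply/(tsat_or_ext X side); exact: IH.
- move=> A k l m x u y v z w _ IH M X hA s Xs.
  have [s' Xs' /eq_map_cat[|e1 /eq_map_cat[|e2 e3]]] := IH M X hA s Xs;
    rewrite ?size_tuple//.
  by exists s' => //; do 2!(apply/eq_map_cat; [by rewrite !size_tuple|split=> //]).
- move=> A k l x u y v _ IH M X hA s Xs.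
  have [s' Xs' /eq_map_cat[|e1 _]] := IH M X hA s Xs; rewrite ?size_tuple//.
  by exists s'.
- move=> A n x y z _ IH1 _ IH2 M X hA s Xs.
  have [s' Xs' ->] := IH1 M X hA s Xs; exact: IH2.
- move=> A n x y z a uz az fx fy _ IH1 _ IH2 M X hA.
  apply/tsat_fo => s Xs; have [s' Xs' e] := IH1 M X hA s Xs.
  have /tsat_fo h := IH2 M X hA.
  by apply/(tfo_subs az fx fy e); exact: h.
- move=> A B n x y z a uz az fx fy uy yx BA yB _ IH M X hA.
  apply/tsat_fo => s0 Xs0; apply: contrapT => na.
  (* Suppose the formula fails at [s0]. Copying the values of [x] under [s0] to [y] throughout the
     team refutes the instance at [y] everywhere, and [f s0] witnesses the inclusion atom for all.
     The subderivation then makes a nonempty team empty. *)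
  pose f s := upds s y (map s0 x).
  have sz : size (map s0 x) = size y by rewrite size_map !size_tuple.
  have fo s : off y s (f s) by exact: upds_off.
  have fy' s : map (f s) y = map s0 x by exact: map_upds.
  have fx0 : map (f s0) x = map s0 x.
    apply/esym/(map_off (fo s0)) => v vx; apply/negP => /yx; by rewrite vx.
  suff : f @` X = set0 by move/seteqP => [h _]; apply: (h (f s0)); exists s0.
  apply: (IH M) => q [Bq|[->|->]] /=.
  + apply: tsat_local1 (hA q (BA _ Bq)).
    have ag s : agree (fv q) s (f s).
      by move=> v qv; apply: fo; apply/negP => /yB /(_ q Bq).
    by split=> [s Xs|_ [s Xs <-]]; [exists (f s) => //; exists s|exists s].
  + move=> _ [s Xs <-]; exists (f s0); first by exists s0.
    by rewrite fy' fx0.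
  + by move=> _ [s Xs <-] /(tfo_subs az fx fy (fy' s)).
- move=> A n x y z w wx wy wz _ IH M X hA; have /= h := IH M X hA.
  have mw (s : var -> M) c (r : seq var) : w \notin r -> map (upd s w c) r = map s r.
    by move=> wr; apply/eq_in_map => v vr; rewrite updN// => e; rewrite -e vr in wr.
  (* The new variable receives the value of [z] at each possible witness for the given atom. *)
  exists [set t | exists s s', [/\ X s, X s', map s x = map s' y & t = upd s w (s' z)]].
    split=> [s Xs|_ [s [s' [Xs _ _ ->]]]]; last by exists s => //; exists (s' z).
    have [s' Xs' e] := h s Xs; exists (upd s w (s' z)); last by exists (s' z).
    by exists s, s'.
  move=> _ [s [s' [Xs Xs' e ->]]].
  (* The witness [s'] must itself be extended at [w] to lie in the new team, which takes a witness
     for [s'] in turn. *)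
  have [s2 Xs2 e2] := h s' Xs'.
  exists (upd s' w (s2 z)); first by exists s', s2.
  apply/eq_map_cat; first by rewrite !size_tuple.
  by rewrite (mw _ _ x)// (mw _ _ y)// e; split=> //=; rewrite updE updN//; exact/nesym.
- move=> A n x y z w wx wy wz _ IH M X hA; have /= h := IH M X hA.
  have mw (s : var -> M) c (r : seq var) : w \notin r -> map (upd s w c) r = map s r.
    by move=> wr; apply/eq_in_map => v vr; rewrite updN// => e; rewrite -e vr in wr.
  move=> _ [s Xs [c ->]]; have [s' Xs' e] := h s Xs.
  (* The universal quantifier provides all variants of [s'] at [w], in particular the one taking the
     value of [z] under [s]. *)
  exists (upd s' w (s z)); first by exists s' => //; exists (s z).
  apply/eq_map_cat; first by rewrite !size_tuple.
  by rewrite (mw _ _ x)// (mw _ _ y)// e; split=> //=; rewrite updE updN//; exact/nesym.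
- by move=> A n m x y z p side _ IH M X hA; apply/(tsat_sim X side); exact: IH.
- by move=> A n m x y z p side _ IH M X hA; apply/(tsat_sim X side); exact: IH.
- move=> A x u v k n rho sigma a p rsx xp uv uvf _ IH M X hA.
  apply: tsat_ex_incl_ext => //; last exact: IH.
  move=> w /uvf[wx aw pw]; split=> //; [move/fo_fv_occ|move/fv_occ] => //.
Qed.

(** * Return to teams with a domain *)

Theorem mainTheorem2 (L : signature) (Gamma : set (inc L)) (phi : inc L) :
  deriv Gamma phi -> entails Gamma phi.
Proof.
move=> d M V X XV GV phiV hG; have [m0 _] := two_elements M.
(* Values outside the domain are filled in with the arbitrary element [m0]; all free variables of
   [Gamma] and [phi] lie inside it. *)
pose f (s : assignment M) v := odflt m0 (s v).
have l (q : inc L) : fv q `<=` V -> lift (represents (fv q)) X [set f s | s in X].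
  move=> qV; have r s : X s -> represents (fv q) s (f s).
    by move=> Xs v /qV /(XV s Xs v); rewrite /f; case: (s v).
  by split=> [s Xs|_ [s Xs <-]]; [exists (f s); [exists s|exact: r]|exists s => //; exact: r].
apply/(team_sat_tsat (l _ phiV)); apply: (deriv_tsat d) => q Gq.
by apply/(team_sat_tsat (l _ (GV q Gq))); exact: hG.
Qed.
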